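(* Let $\lambda>0$ and let $\{(A_k,B_k)\}_{k\ge1}$ be the sequence of iterates generated by the softImpute-ALS algorithm (as defined in the context). Then: (a) Every limit point $(A_*,B_* )$ of $\{(A_k,B_k)\}_k$ is a first order stationary point of the problem $\min_{A,B}F(A,B)$, i.e. $\nabla_AF(A_*,B_* )=0$ and $\nabla_BF(A_*,B_* )=0$. (b) Let $B_*$ be any limit point of the sequence $B_k$, $k\ge1$, with $B_\nu\to B_*$ along a subsequence $\nu$ of $\{1,2,\dots\}$. Then the sequence $A_\nu$ (the $A_k$ along the same subsequence) converges. Similarly, let $A_*$ be any limit point of the sequence $A_k$, $k\ge1$, with $A_\mu\to A_*$ along a subsequence $\mu$ of $\{1,2,\dots\}$. Then the sequence $B_\mu$ converges.
   Context: Let $X$ be an $m\times n$ real matrix whose entries are observed on an index set $\Omega\subseteq\{1,\dots,m\}\times\{1,\dots,n\}$. $P_\Omega(M)$ denotes the $m\times n$ matrix that agrees with $M$ on $\Omega$ and is $0$ elsewhere, and $P_\Omega^\perp(M)=M-P_\Omega(M)$. Fix $r\le\min(m,n)$. For $A\in\mathbb{R}^{m\times r}$, $B\in\mathbb{R}^{n\times r}$ define $$F(A,B)=\tfrac12\|P_\Omega(X-AB^T)\|_F^2+\tfrac\lambda2\|A\|_F^2+\tfrac\lambda2\|B\|_F^2,$$ $$Q_A(Z_1|A,B)=\tfrac12\|P_\Omega(X-Z_1B^T)+P_\Omega^\perp(AB^T-Z_1B^T)\|_F^2+\tfrac\lambda2\|Z_1\|_F^2+\tfrac\lambda2\|B\|_F^2,$$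 $$Q_B(Z_2|A,B)=\tfrac12\|P_\Omega(X-AZ_2^T)+P_\Omega^\perp(AB^T-AZ_2^T)\|_F^2+\tfrac\lambda2\|A\|_F^2+\tfrac\lambda2\|Z_2\|_F^2,$$ for $Z_1\in\mathbb{R}^{m\times r}$, $Z_2\in\mathbb{R}^{n\times r}$. $\nabla_AF$, $\nabla_BF$ are the partial gradients of $F$ with respect to $A$ and $B$. The softImpute-ALS iterates, from an arbitrary starting pair, are given by $$A_{k+1}=\arg\min_{Z_1}Q_A(Z_1|A_k,B_k)=X^*B_k(B_k^TB_k+\lambda I)^{-1},\quad X^*=P_\Omega(X)+P_\Omega^\perp(A_kB_k^T),$$ $$B_{k+1}=\arg\min_{Z_2}Q_B(Z_2|A_{k+1},B_k)=X^{*T}A_{k+1}(A_{k+1}^TA_{k+1}+\lambda I)^{-1},\quad X^*=P_\Omega(X)+P_\Omega^\perp(A_{k+1}B_k^T).$$ A limit point of a sequence is the limit of some subsequence. *)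

(* Defs.v *)
From HB Require Import structures.
From mathcomp Require Import all_boot all_order all_algebra.
From mathcomp Require Import all_classical all_reals all_analysis.
From mathcomp Require Import ring lra.
Import Order.TTheory GRing.Theory Num.Theory.
Import numFieldNormedType.Exports.

Set Implicit Arguments.
Unset Strict Implicit.
Unset Printing Implicit Defensive.

Local Open Scope classical_set_scope.
Local Open Scope ring_scope.

(* The library norm on matrices is the sup norm of the entries; it only
   provides the (usual, finite-dimensional) topology here.  The norm appearing
   in the objective functions is the Frobenius norm [fnorm]. *)

Section objective.
Context {R : realType} {m n r : nat}.

Definition fnorm {p q : nat} (M : 'M[R]_(p, q)) : R :=
  Num.sqrt (\sum_i \sum_j M i j ^+ 2).

Definition POmega (Omega : {set 'I_m * 'I_n}) (M : 'M[R]_(m, n)) : 'M[R]_(m, n) :=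
  \matrix_(i, j) (if (i, j) \in Omega then M i j else 0).

Definition POmega_perp (Omega : {set 'I_m * 'I_n}) (M : 'M[R]_(m, n)) :
    'M[R]_(m, n) :=
  M - POmega Omega M.

Variables (X : 'M[R]_(m, n)) (Omega : {set 'I_m * 'I_n}) (lambda : R).

Definition F (A : 'M[R]_(m, r)) (B : 'M[R]_(n, r)) : R :=
  2^-1 * fnorm (POmega Omega (X - A *m B^T)) ^+ 2
  + lambda / 2 * fnorm A ^+ 2 + lambda / 2 * fnorm B ^+ 2.

(* [QA Z1 A B] is $Q_A(Z_1 | A, B)$ and [QB Z2 A B] is $Q_B(Z_2 | A, B)$. *)
Definition QA (Z1 A : 'M[R]_(m, r)) (B : 'M[R]_(n, r)) : R :=
  2^-1 * fnorm (POmega Omega (X - Z1 *m B^T)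
                + POmega_perp Omega (A *m B^T - Z1 *m B^T)) ^+ 2
  + lambda / 2 * fnorm Z1 ^+ 2 + lambda / 2 * fnorm B ^+ 2.

Definition QB (Z2 : 'M[R]_(n, r)) (A : 'M[R]_(m, r)) (B : 'M[R]_(n, r)) : R :=
  2^-1 * fnorm (POmega Omega (X - A *m Z2^T)
                + POmega_perp Omega (A *m B^T - A *m Z2^T)) ^+ 2
  + lambda / 2 * fnorm A ^+ 2 + lambda / 2 * fnorm Z2 ^+ 2.

Definition is_argmin {T : Type} (f : T -> R) (z : T) : Prop :=
  forall z', f z <= f z'.

(* The sequences are indexed by k >= 1: (A 1, B 1) is an arbitrary starting
   pair and (A 0, B 0) is irrelevant.  For lambda > 0 the minimizers are unique
   and given by the ridge-regression formulas, see [is_argmin_QA] and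
   [is_argmin_QB] below. *)
Definition softImpute_ALS (A : nat -> 'M[R]_(m, r)) (B : nat -> 'M[R]_(n, r)) :
    Prop :=
  forall k, (1 <= k)%N ->
    is_argmin (fun Z1 => QA Z1 (A k) (B k)) (A k.+1) /\
    is_argmin (fun Z2 => QB Z2 (A k.+1) (B k)) (B k.+1).

(* The gradient for the Frobenius inner product, i.e. the matrix of the partial
   derivatives with respect to the entries ([delta_mx i j] is the (i, j)
   elementary matrix).  [F] is derivable in each argument in every direction,
   see [is_derive_FA] and [is_derive_FB] below, so that no default value of
   ['D_] is involved. *)
Definition gradient {p q : nat} (f : 'M[R]_(p, q) -> R) (M : 'M[R]_(p, q)) :
    'M[R]_(p, q) :=
  \matrix_(i, j) 'D_(delta_mx i j) f M.

Definition gradA (A : 'M[R]_(m, r)) (B : 'M[R]_(n, r)) : 'M[R]_(m, r) :=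
  gradient (fun A' => F A' B) A.

Definition gradB (A : 'M[R]_(m, r)) (B : 'M[R]_(n, r)) : 'M[R]_(n, r) :=
  gradient (fun B' => F A B') B.

Definition stationary (A : 'M[R]_(m, r)) (B : 'M[R]_(n, r)) : Prop :=
  gradA A B = 0 /\ gradB A B = 0.

End objective.

Definition subsequence_of_pos (nu : nat -> nat) : Prop :=
  (forall i, (1 <= nu i)%N) /\ increasing_seq nu.

(* Not the library's [limit_point], which concerns a set rather than a sequence
   (an eventually constant sequence has a limit here). *)
Definition seq_limit_point {T : topologicalType} (u : nat -> T) (l : T) : Prop :=
  exists nu : nat -> nat,
    subsequence_of_pos nu /\ (fun i => u (nu i)) @ \oo --> l.

Section sanity.
Context {R : realType}.

Definition fdot {p q : nat} (M N : 'M[R]_(p, q)) : R :=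
  \sum_i \sum_j M i j * N i j.

Lemma fnorm_sqr p q (M : 'M[R]_(p, q)) : fnorm M ^+ 2 = fdot M M.
Proof.
rewrite sqr_sqrtr; last by do 2!apply: sumr_ge0 => ? _; exact: sqr_ge0.
by [].
Qed.

Lemma fdotDl p q (M N P : 'M[R]_(p, q)) : fdot (M + N) P = fdot M P + fdot N P.
Proof.
rewrite /fdot -big_split; apply: eq_bigr => i _ /=; rewrite -big_split.
by apply: eq_bigr => j _; rewrite mxE mulrDl.
Qed.

Lemma fdotZl p q a (M P : 'M[R]_(p, q)) : fdot (a *: M) P = a * fdot M P.
Proof.
rewrite /fdot big_distrr; apply: eq_bigr => i _; rewrite big_distrr.
by apply: eq_bigr => j _; rewrite /= mxE mulrA.
Qed.

Lemma fdotC p q (M N : 'M[R]_(p, q)) : fdot M N = fdot N M.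
Proof. by do 2!apply: eq_bigr => ? _; exact: mulrC. Qed.

Lemma fdot_ge0 p q (M : 'M[R]_(p, q)) : 0 <= fdot M M.
Proof. by rewrite -fnorm_sqr sqr_ge0. Qed.

Lemma fdot_eq0 p q (M : 'M[R]_(p, q)) : fdot M M = 0 -> M = 0.
Proof.
move=> /eqP; rewrite psumr_eq0; last first.
  by move=> i _; apply: sumr_ge0 => j _; rewrite -expr2 sqr_ge0.
move=> /allP M0; apply/matrixP => i j; rewrite mxE.
have /= := M0 i (mem_index_enum i); rewrite psumr_eq0; last first.
  by move=> k _; rewrite -expr2 sqr_ge0.
by move=> /allP/(_ j (mem_index_enum j))/=; rewrite -expr2 sqrf_eq0 => /eqP.
Qed.

Lemma fdot_mulmx p q s (M : 'M[R]_(p, q)) (H : 'M[R]_(p, s)) (Y : 'M[R]_(q, s)) :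
  fdot M (H *m Y^T) = fdot (M *m Y) H.
Proof.
apply: eq_bigr => i _.
under eq_bigr => j _ do rewrite mxE mulr_sumr.
under [RHS]eq_bigr => j _ do rewrite mxE mulr_suml.
rewrite exchange_big; apply: eq_bigr => k _; apply: eq_bigr => j _.
by rewrite mxE; ring.
Qed.

Lemma fdot_tr p q (M N : 'M[R]_(p, q)) : fdot M^T N^T = fdot M N.
Proof.
rewrite /fdot exchange_big; do 2!apply: eq_bigr => ? _.
by rewrite !mxE.
Qed.

Lemma fnorm_sqrD p q (M N : 'M[R]_(p, q)) (h : R) :
  fnorm (M + h *: N) ^+ 2
  = fnorm M ^+ 2 + h * (2 * fdot M N) + h ^+ 2 * fnorm N ^+ 2.
Proof.
rewrite !fnorm_sqr fdotDl fdotC fdotDl fdotZl.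
rewrite fdotZl (fdotC N (_ + _)) fdotDl fdotZl (fdotC N M); ring.
Qed.

Lemma ridge_unit q s (Y : 'M[R]_(q, s)) (lambda : R) : 0 < lambda ->
  Y^T *m Y + lambda%:M \in unitmx.
Proof.
move=> l0; rewrite -row_free_unit -kermx_eq0; apply/rowV0P => v.
move=> /sub_kermxP; rewrite mulmxDr mul_mx_scalar => E.
have : fdot (v *m (Y^T *m Y) + lambda *: v) v = 0.
  by rewrite E /fdot !big1// => i _; rewrite big1// => j _; rewrite mxE mul0r.
rewrite fdotDl fdotZl mulmxA -fdot_mulmx => E'.
apply: fdot_eq0; apply: le_anti; rewrite fdot_ge0 andbT.
have := fdot_ge0 (v *m Y^T); have := fdot_ge0 v; move: E'.
by set a := fdot _ _; set b := fdot _ _ => E' b0 a0; nra.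
Qed.

Lemma is_argmin_ridge p q s (M : 'M[R]_(p, q)) (Y : 'M[R]_(q, s)) (lambda c : R)
    (f : 'M[R]_(p, s) -> R) :
  0 < lambda ->
  (forall Z, f Z = 2^-1 * fnorm (M - Z *m Y^T) ^+ 2
                   + lambda / 2 * fnorm Z ^+ 2 + c) ->
  forall Z, is_argmin f Z <-> Z = M *m Y *m invmx (Y^T *m Y + lambda%:M).
Proof.
move=> l0 fE; set G := _ + _; set Z0 := _ *m invmx _.
have f0 Z : f Z = f Z0 + 2^-1 * fnorm ((Z - Z0) *m Y^T) ^+ 2
                  + lambda / 2 * fnorm (Z - Z0) ^+ 2.
  have Z0G : (M - Z0 *m Y^T) *m Y = lambda *: Z0.
    have : Z0 *m G = M *m Y by rewrite mulmxKV //; exact: ridge_unit.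
    rewrite /G mulmxDr mul_mx_scalar mulmxBl -(mulmxA Z0) => <-.
    by rewrite addrC addKr.
  rewrite !fE; set H := Z - Z0.
  have -> : Z = Z0 + 1 *: H by rewrite scale1r addrC subrK.
  have -> : M - (Z0 + 1 *: H) *m Y^T = (M - Z0 *m Y^T) + (-1) *: (H *m Y^T).
    by rewrite scale1r mulmxDl scaleN1r opprD addrA.
  rewrite !fnorm_sqrD fdot_mulmx Z0G fdotZl; by field.
move=> Z; split => [/(_ Z0)|-> Z']; last first.
  rewrite (f0 Z') -addrA lerDl addr_ge0// mulr_ge0// ?sqr_ge0// ?invr_ge0//.
  by rewrite divr_ge0// ltW.
rewrite (f0 Z) => ZZ0; apply/eqP; rewrite -subr_eq0; apply/eqP/fdot_eq0.
rewrite -fnorm_sqr; apply: le_anti; rewrite sqr_ge0 andbT.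
have := sqr_ge0 (fnorm ((Z - Z0) *m Y^T)); have := sqr_ge0 (fnorm (Z - Z0)).
move: ZZ0; set a := _ ^+ 2; set b := _ ^+ 2 => ab b0 a0; nra.
Qed.

Context {m n r : nat} (X : 'M[R]_(m, n)) (Omega : {set 'I_m * 'I_n}).
Context (lambda : R).
Implicit Types (A : 'M[R]_(m, r)) (B : 'M[R]_(n, r)).

Let fill A B : 'M[R]_(m, n) := POmega Omega X + POmega_perp Omega (A *m B^T).

Lemma fillE A B (W : 'M[R]_(m, n)) :
  POmega Omega (X - W) + POmega_perp Omega (A *m B^T - W) = fill A B - W.
Proof.
by apply/matrixP => i j; rewrite !mxE; case: ifP => _; ring.
Qed.

Lemma is_argmin_QA A B (Z : 'M[R]_(m, r)) : 0 < lambda ->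
  is_argmin (fun Z1 => QA X Omega lambda Z1 A B) Z <->
  Z = (POmega Omega X + POmega_perp Omega (A *m B^T)) *m B
      *m invmx (B^T *m B + lambda%:M).
Proof.
move=> l0; apply: (@is_argmin_ridge _ _ _ _ _ _ (lambda / 2 * fnorm B ^+ 2)) => //.
by move=> Z1; rewrite /QA fillE.
Qed.

Lemma is_argmin_QB A B (Z : 'M[R]_(n, r)) : 0 < lambda ->
  is_argmin (fun Z2 => QB X Omega lambda Z2 A B) Z <->
  Z = (POmega Omega X + POmega_perp Omega (A *m B^T))^T *m A
      *m invmx (A^T *m A + lambda%:M).
Proof.
move=> l0; apply: (@is_argmin_ridge _ _ _ _ _ _ (lambda / 2 * fnorm A ^+ 2)) => //.
move=> Z2; rewrite /QB fillE [in RHS]fnorm_sqr -fdot_tr -fnorm_sqr.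
by rewrite !raddfB/= !trmxK trmx_mul trmxK addrAC.
Qed.

Lemma is_derive_quadratic p q (f : 'M[R]_(p, q) -> R) M V (c d : R) :
  (forall h : R, f (h *: V + M) = f M + h * c + h ^+ 2 * d) ->
  is_derive M V f c.
Proof.
move=> fE; have lim : h^-1 *: ((f \o shift M) (h *: V) - f M) @[h --> 0^'] --> c.
  have : c + h * d @[h --> 0^'] --> c + 0 * d.
    apply: cvgD; first exact: cvg_cst.
    apply: cvgM; last exact: cvg_cst.
    exact: (cvg_within_filter (f := id)).
  rewrite mul0r addr0; apply: cvg_trans; apply: near_eq_cvg.
  near=> h; rewrite /= fE.
  have h0 : h != 0 by near: h; exact: nbhs_dnbhs_neq.
  by rewrite /GRing.scale/=; field.
split; first by apply/cvg_ex; exists c.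
exact/cvg_lim.
Unshelve. all: by end_near. Qed.

Lemma POmegaD (M N : 'M[R]_(m, n)) :
  POmega Omega (M + N) = POmega Omega M + POmega Omega N.
Proof. by apply/matrixP => i j; rewrite !mxE; case: ifP; rewrite ?addr0. Qed.

Lemma POmegaZ a (M : 'M[R]_(m, n)) : POmega Omega (a *: M) = a *: POmega Omega M.
Proof. by apply/matrixP => i j; rewrite !mxE; case: ifP; rewrite ?mulr0. Qed.

Lemma fdot_POmega (M N : 'M[R]_(m, n)) :
  fdot (POmega Omega M) (POmega Omega N) = fdot (POmega Omega M) N.
Proof.
by do 2!apply: eq_bigr => ? _; rewrite !mxE; case: ifP; rewrite ?mul0r.
Qed.

Lemma is_derive_FA A B (V : 'M[R]_(m, r)) :
  is_derive A V (fun A' => F X Omega lambda A' B)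
    (fdot (lambda *: A - POmega Omega (X - A *m B^T) *m B) V).
Proof.
set P := POmega Omega (X - A *m B^T).
apply: (@is_derive_quadratic _ _ _ _ _ _
  (2^-1 * fnorm (POmega Omega (V *m B^T)) ^+ 2 + lambda / 2 * fnorm V ^+ 2)).
move=> h; rewrite /F (addrC (h *: V)).
have -> : X - (A + h *: V) *m B^T = X - A *m B^T + (- h) *: (V *m B^T).
  by rewrite mulmxDl opprD addrA scaleNr -scalemxAl.
rewrite POmegaD POmegaZ !fnorm_sqrD -/P fdot_POmega fdot_mulmx.
rewrite fdotDl fdotZl -(scaleN1r (P *m B)) fdotZl; by field.
Qed.

Lemma is_derive_FB A B (V : 'M[R]_(n, r)) :
  is_derive B V (fun B' => F X Omega lambda A B')
    (fdot (lambda *: B - (POmega Omega (X - A *m B^T))^T *m A) V).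
Proof.
set P := POmega Omega (X - A *m B^T).
apply: (@is_derive_quadratic _ _ _ _ _ _
  (2^-1 * fnorm (POmega Omega (A *m V^T)) ^+ 2 + lambda / 2 * fnorm V ^+ 2)).
move=> h; rewrite /F (addrC (h *: V)).
have -> : X - A *m (B + h *: V)^T = X - A *m B^T + (- h) *: (A *m V^T).
  by rewrite raddfD/= linearZ/= mulmxDr opprD addrA scaleNr -scalemxAr.
rewrite POmegaD POmegaZ !fnorm_sqrD -/P fdot_POmega.
rewrite -(fdot_tr P) trmx_mul trmxK fdot_mulmx.
rewrite fdotDl fdotZl -(scaleN1r (P^T *m A)) fdotZl; by field.
Qed.

End sanity.

(* Main.v *)
(* The surrogate [QA] majorizes [F], with equality at the current iterate, and
   is [lambda]-strongly convex, so each half-step decreases [F] by at least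
   [lambda / 2] times its squared length; as [F >= 0], successive differences
   tend to 0.  The normal equations of the half-step read
   grad_A F(A_k, B_k) = (A_k - A_(k+1)) (B_k^T B_k + lambda I), so this partial
   gradient tends to 0 along every subsequence on which B_k converges.  For a
   fixed B the map A |-> grad_A F(A, B) is affine with a coercive linear part:
   it has a unique zero, to which A_k must converge along that subsequence.
   The statements about B follow by transposing X and Omega, using
   A_(k+1) - A_k --> 0 to replace A_k by A_(k+1). *)
Require Import Defs.
From HB Require Import structures.
From mathcomp Require Import all_boot all_order all_algebra.
From mathcomp Require Import all_classical all_reals all_analysis.
From mathcomp Require Import ring lra.
Import Order.TTheory GRing.Theory Num.Theory.
Import numFieldNormedType.Exports.

Local Open Scope classical_set_scope.
Local Open Scope ring_scope.

(** * Entrywise limits of matrix-valued functions along a filter *)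

Section MatrixLimits.
Context {R : realType} {T : Type} {G : set_system T} {FG : Filter G}.

Lemma cvg_mxP p q (f : T -> 'M[R]_(p, q)) (M : 'M[R]_(p, q)) :
  f @ G --> M <-> forall i j, f x i j @[x --> G] --> M i j.
Proof.
split=> [fM i j|fM].
  exact: (cvg_comp f (fun N : 'M[R]_(p, q) => N i j) fM (@coord_continuous _ p q i j M)).
(* A neighbourhood of a matrix contains a product of neighbourhoods [P i j] of its entries; there
   are finitely many entries, so the filter contains the intersection. *)
move=> S [P MP PS]; apply: filterS PS _.
change (G [set x | forall i j, P i j (f x i j)]).
by apply: filter_forall => i; apply: filter_forall => j; exact: (fM i j).
Qed.

Lemma cvg_sum (I : finType) (f : I -> T -> R) (l : I -> R) :
  (forall i, f i @ G --> l i) -> \sum_i f i x @[x --> G] --> \sum_i l i.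
Proof. by move=> fl; apply: cvg_big => [|i _]; [exact: add_continuous|exact: fl]. Qed.

Lemma cvg_mulmx p q s (f : T -> 'M[R]_(p, q)) (g : T -> 'M[R]_(q, s))
    (M : 'M[R]_(p, q)) (N : 'M[R]_(q, s)) :
  f @ G --> M -> g @ G --> N -> f x *m g x @[x --> G] --> M *m N.
Proof.
move=> /cvg_mxP fM /cvg_mxP gN; apply/cvg_mxP => i j; rewrite mxE.
under eq_fun do rewrite mxE.
by apply: cvg_sum => k; apply: cvgM.
Qed.

Lemma cvg_trmx p q (f : T -> 'M[R]_(p, q)) (M : 'M[R]_(p, q)) :
  f @ G --> M -> (f x)^T @[x --> G] --> M^T.
Proof.
move=> /cvg_mxP fM; apply/cvg_mxP => i j; rewrite mxE.
by under eq_fun do rewrite mxE; exact: fM.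
Qed.

Lemma cvg_POmega p q (Omega : {set 'I_p * 'I_q}) (f : T -> 'M[R]_(p, q)) (M : 'M[R]_(p, q)) :
  f @ G --> M -> POmega Omega (f x) @[x --> G] --> POmega Omega M.
Proof.
move=> /cvg_mxP fM; apply/cvg_mxP => i j; rewrite mxE.
under eq_fun do rewrite mxE.
by case: ifP => _; [exact: fM|exact: cvg_cst].
Qed.

Lemma cvg_fdot0 p q (f : T -> 'M[R]_(p, q)) :
  f @ G --> (0 : 'M[R]_(p, q)) -> fdot (f x) (f x) @[x --> G] --> (0 : R).
Proof.
move=> /cvg_mxP f0.
have -> : 0 = \sum_(i < p) \sum_(j < q) ((0 : R) * 0).
  by rewrite big1// => i _; rewrite big1// => j _; rewrite mul0r.
apply: cvg_sum => i; apply: cvg_sum => j.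
by have := f0 i j; rewrite mxE => f0ij; apply: cvgM.
Qed.

(** Each entry is at most [Num.sqrt (u x)] in absolute value, so it is squeezed to 0. *)
Lemma fdot0_cvg p q (f : T -> 'M[R]_(p, q)) (u : T -> R) :
  (forall x, fdot (f x) (f x) <= u x) -> u @ G --> (0 : R) ->
  f @ G --> (0 : 'M[R]_(p, q)).
Proof.
move=> fu u0; apply/cvg_mxP => i j; rewrite mxE.
apply/norm_cvg0P.
have s0 : Num.sqrt (u x) @[x --> G] --> (0 : R).
  by rewrite -[X in _ --> X]sqrtr0; apply: continuous_cvg u0; exact: sqrt_continuous.
apply: squeeze_cvgr (cvg_cst 0) s0; apply: nearW => x; rewrite normr_ge0/=.
rewrite -sqrtr_sqr ler_wsqrtr// (le_trans _ (fu x))//.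
rewrite /fdot (bigD1 i)//= (bigD1 j)//= expr2 -addrA lerDl addr_ge0//.
  by apply: sumr_ge0 => k _; rewrite -expr2 sqr_ge0.
by do 2!apply: sumr_ge0 => ? _; rewrite -expr2 sqr_ge0.
Qed.

End MatrixLimits.

Lemma increasing_cvg_oo {T : topologicalType} (u : nat -> T) (l : T) (nu : nat -> nat) :
  increasing_seq nu -> u @ \oo --> l -> (fun i => u (nu i)) @ \oo --> l.
Proof.
move=> nu_incr; apply: cvg_comp => S [N _ NS]; exists N => // i /= Ni.
apply: NS => /=; apply: (leq_trans Ni).
(* Strict monotonicity gives [i <= nu i] by induction. *)
elim: i {Ni} => // i IH; apply: (leq_ltn_trans IH).
by have /increasing_seqP := nu_incr; exact.
Qed.

(** * Ridge regression: normal equation and quadratic growth *)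

Section Ridge.
Context {R : realType} {p q s : nat}.
Context (M : 'M[R]_(p, q)) (Y : 'M[R]_(q, s)) (lambda : R).

Lemma ridge_normal_equation (Z : 'M[R]_(p, s)) : 0 < lambda ->
  Z = M *m Y *m invmx (Y^T *m Y + lambda%:M) ->
  (M - Z *m Y^T) *m Y = lambda *: Z.
Proof.
move=> l0 ->; set Z0 := _ *m invmx _.
have : Z0 *m (Y^T *m Y + lambda%:M) = M *m Y.
  by rewrite mulmxKV //; exact: ridge_unit.
rewrite mulmxDr mul_mx_scalar mulmxBl -(mulmxA Z0) => <-.
by rewrite addrC addKr.
Qed.

(** Expanding at [Z] in the direction [H = Z' - Z], the linear terms cancel by the normal equation;
    the remaining [2^-1 * fnorm (H *m Y^T) ^+ 2] is nonnegative and dropped. *)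
Lemma ridge_growth (Z Z' : 'M[R]_(p, s)) :
  (M - Z *m Y^T) *m Y = lambda *: Z ->
  2^-1 * fnorm (M - Z *m Y^T) ^+ 2 + lambda / 2 * fnorm Z ^+ 2
    + lambda / 2 * fnorm (Z' - Z) ^+ 2
  <= 2^-1 * fnorm (M - Z' *m Y^T) ^+ 2 + lambda / 2 * fnorm Z' ^+ 2.
Proof.
move=> ZG; set H := Z' - Z.
have -> : Z' = Z + 1 *: H by rewrite scale1r addrC subrK.
have -> : M - (Z + 1 *: H) *m Y^T = (M - Z *m Y^T) + (-1) *: (H *m Y^T).
  by rewrite scale1r mulmxDl scaleN1r opprD addrA.
rewrite !fnorm_sqrD fdot_mulmx ZG fdotZl.
have := sqr_ge0 (fnorm (H *m Y^T)); lra.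
Qed.

End Ridge.

Definition trset {m n : nat} (Omega : {set 'I_m * 'I_n}) : {set 'I_n * 'I_m} :=
  [set ji | (ji.2, ji.1) \in Omega].

Lemma fnorm_tr {R : realType} {p q : nat} (M : 'M[R]_(p, q)) : fnorm M^T = fnorm M.
Proof.
by congr (Num.sqrt _); rewrite exchange_big; do 2!apply: eq_bigr => ? _; rewrite mxE.
Qed.

Lemma fdot_delta {R : realType} {p q : nat} (M : 'M[R]_(p, q)) i j :
  fdot M (delta_mx i j) = M i j.
Proof.
rewrite /fdot (bigD1 i)//= (bigD1 j)//= !mxE !eqxx mulr1.
rewrite big1 => [|k /negbTE kj]; last by rewrite mxE kj andbF mulr0.
rewrite big1 ?addr0// => k /negbTE ki; rewrite big1// => l _.
by rewrite mxE ki mulr0.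
Qed.

(** * The partial gradient in [A] and its behaviour under a half-step *)

Section PartialGradient.
Context {R : realType} {m n r : nat}.
Context (X : 'M[R]_(m, n)) (Omega : {set 'I_m * 'I_n}) (lambda : R).
Implicit Types (A : 'M[R]_(m, r)) (B : 'M[R]_(n, r)).

(* The partial gradient of [F] in [A], see [gradA_pgrad]; the one in [B] is
   [pgrad] of the transposed data, see [gradB_pgrad]. *)
Definition pgrad A B : 'M[R]_(m, r) :=
  lambda *: A - POmega Omega (X - A *m B^T) *m B.

Lemma F_ge0 A B : 0 < lambda -> 0 <= F X Omega lambda A B.
Proof.
move=> l0; have l2 : 0 <= lambda / 2 by rewrite divr_ge0// ltW.
by rewrite /F !addr_ge0// mulr_ge0// ?sqr_ge0// invr_ge0.
Qed.

Lemma trmx_POmega (M : 'M[R]_(m, n)) :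
  (POmega Omega M)^T = POmega (trset Omega) M^T.
Proof. by apply/matrixP => i j; rewrite !mxE inE. Qed.

Lemma trmx_POmega_perp (M : 'M[R]_(m, n)) :
  (POmega_perp Omega M)^T = POmega_perp (trset Omega) M^T.
Proof. by rewrite /POmega_perp raddfB /= trmx_POmega. Qed.

Lemma fnorm_POmega_le (M : 'M[R]_(m, n)) :
  fnorm (POmega Omega M) ^+ 2 <= fnorm M ^+ 2.
Proof.
rewrite !fnorm_sqr; do 2!apply: ler_sum => ? _.
by rewrite mxE; case: ifP => //; rewrite mul0r -expr2 sqr_ge0.
Qed.

Lemma QA_step A B A' : 0 < lambda ->
  is_argmin (fun Z => QA X Omega lambda Z A B) A' ->
  F X Omega lambda A' B + lambda / 2 * fnorm (A - A') ^+ 2 <= F X Omega lambda A B /\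
  pgrad A B = (A - A') *m (B^T *m B + lambda%:M).
Proof.
move=> l0 /(is_argmin_QA _ _ _ _ _ l0).
set W := POmega _ _ + _ => /(ridge_normal_equation _ _ _ _ l0) WA'.
(* The completed matrix [W] equals [A *m B^T] off [Omega], so the surrogate agrees with [F] at [A];
   it equals [X] on [Omega] ([PW]), so the surrogate dominates [F] at [A']. *)
have WA : W - A *m B^T = POmega Omega (X - A *m B^T).
  by apply/matrixP => i j; rewrite !mxE; case: ifP => _; ring.
have PW : POmega Omega (X - A' *m B^T) = POmega Omega (W - A' *m B^T).
  by apply/matrixP => i j; rewrite !mxE; case: ifP => _ //; ring.
split.
  have := ridge_growth _ _ _ _ A WA'; rewrite WA /F PW.
  have := fnorm_POmega_le (W - A' *m B^T); lra.
(* Multiplied by [B], the first residual becomes [lambda *: A'] by the normal equation, leaving only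
   multiples of [A - A'] in the gradient. *)
have WE : W - A *m B^T = (W - A' *m B^T) - (A - A') *m B^T.
  by rewrite mulmxBl; apply/matrixP => i j; rewrite !mxE; ring.
rewrite /pgrad -WA WE mulmxBl WA' mulmxDr mul_mx_scalar -mulmxA.
by rewrite scalerBr opprB addrCA addrC.
Qed.

(** The suffix [B] means subtraction, not the gradient in [B]: at fixed [B] the data [X] cancels and
    the linear part of [pgrad] remains. *)
Lemma pgradB A A0 B :
  pgrad A B - pgrad A0 B
  = lambda *: (A - A0) + POmega Omega ((A - A0) *m B^T) *m B.
Proof.
rewrite /pgrad.
have -> : POmega Omega (X - A *m B^T)
  = POmega Omega (X - A0 *m B^T) - POmega Omega ((A - A0) *m B^T).
  apply/matrixP => i j; rewrite mulmxBl !mxE; case: ifP => _ //; ring.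
by rewrite mulmxBl scalerBr; apply/matrixP => i j; rewrite !mxE; ring.
Qed.

(** With [K] the masked term, the cross term [fdot K E] is the squared norm of
    [POmega Omega (E *m B^T)], hence nonnegative. The constant [lambda ^+ 2] is independent of [B],
    so the bound is uniform along a sequence of [B]s. *)
Lemma ridge_op_coercive E B : 0 < lambda ->
  lambda ^+ 2 * fdot E E
  <= fdot (lambda *: E + POmega Omega (E *m B^T) *m B)
          (lambda *: E + POmega Omega (E *m B^T) *m B).
Proof.
move=> l0; set K := _ *m B.
have KE : 0 <= fdot K E.
  by rewrite -fdot_mulmx -fdot_POmega fdot_ge0.
rewrite !(fdotDl, fdotZl) (fdotC E) (fdotC K) !(fdotDl, fdotZl) (fdotC E K).
have := fdot_ge0 K; nra.
Qed.

Lemma cvg_pgrad {T : Type} {G : set_system T} {FG : Filter G}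
    (A : T -> 'M[R]_(m, r)) (B : T -> 'M[R]_(n, r)) A0 B0 :
  A @ G --> A0 -> B @ G --> B0 -> pgrad (A x) (B x) @[x --> G] --> pgrad A0 B0.
Proof.
move=> cA cB; apply: cvgB; first exact: cvgZr.
apply: cvg_mulmx => //; apply: cvg_POmega; apply: cvgB; first exact: cvg_cst.
by apply: cvg_mulmx => //; exact: cvg_trmx.
Qed.

(** The linear part [L] is injective by coercivity, hence bijective in finite dimension; the zero is
    the preimage of [POmega Omega X *m B]. *)
Lemma pgrad_zero B : 0 < lambda -> exists A, pgrad A B = 0.
Proof.
move=> l0.
pose L A := lambda *: A + POmega Omega (A *m B^T) *m B.
have Llin : linear L.
  move=> a u v; rewrite /L mulmxDl -scalemxAl POmegaD POmegaZ mulmxDl -scalemxAl.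
  by apply/matrixP => i j; rewrite !mxE; ring.
pose L' : {linear 'M[R]_(m, r) -> 'M[R]_(m, r)} :=
  HB.pack L (GRing.isLinear.Build R _ _ _ L Llin).
pose f := linfun L'.
have f0 : lker f == 0%VS.
  apply/lker0P => u v; rewrite !lfunE /= => /eqP; rewrite -subr_eq0.
  rewrite -[L v]scale1r -scaleNr addrC -Llin scaleN1r addrC => /eqP L0.
  apply/eqP; rewrite -subr_eq0; apply/eqP/fdot_eq0/le_anti; rewrite fdot_ge0 andbT.
  have := ridge_op_coercive (u - v) B l0; rewrite -/(L _) L0.
  have -> : fdot (0 : 'M[R]_(m, r)) 0 = 0.
    by rewrite -{1}(scale0r (0 : 'M[R]_(m, r))) fdotZl mul0r.
  by rewrite pmulr_rle0 ?exprn_gt0.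
exists (f^-1%VF (POmega Omega X *m B)); set A := f^-1%VF _.
have LA : L A = POmega Omega X *m B.
  by have := lker0_lfunVK f0 (POmega Omega X *m B); rewrite lfunE.
suff -> : pgrad A B = L A - POmega Omega X *m B by rewrite LA subrr.
have PB : POmega Omega (X - A *m B^T) = POmega Omega X - POmega Omega (A *m B^T).
  by apply/matrixP => i j; rewrite !mxE; case: ifP => _ //; ring.
by rewrite /pgrad PB mulmxBl /L opprB addrA.
Qed.

(** [D] is meant to be the half-step: it vanishes in the limit while the right factor converges with
    [B]. *)
Lemma pgrad_cvg_zero (A D : nat -> 'M[R]_(m, r)) (B : nat -> 'M[R]_(n, r)) B0 :
  B @ \oo --> B0 -> D @ \oo --> (0 : 'M[R]_(m, r)) ->
  (forall i, pgrad (A i) (B i) = D i *m ((B i)^T *m B i + lambda%:M)) ->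
  pgrad (A i) (B i) @[i --> \oo] --> (0 : 'M[R]_(m, r)).
Proof.
move=> cB D0 gD; under eq_fun do rewrite gD.
rewrite -(mul0mx _ (B0^T *m B0 + lambda%:M)).
apply: cvg_mulmx => //; apply: cvgD; last exact: cvg_cst.
by apply: cvg_mulmx => //; exact: cvg_trmx.
Qed.

Lemma cvg_of_pgrad (A : nat -> 'M[R]_(m, r)) (B : nat -> 'M[R]_(n, r)) B0 :
  0 < lambda ->
  B @ \oo --> B0 -> pgrad (A i) (B i) @[i --> \oo] --> (0 : 'M[R]_(m, r)) ->
  cvg (A @ \oo).
Proof.
move=> l0 cB g0; have [A0 A0B0] := pgrad_zero B0 l0.
apply/cvg_ex; exists A0; apply/subr_cvg0.
(* Both gradients are taken at the same [B i], so that [pgradB] and the uniform coercivity bound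
   apply; the second tends to [pgrad A0 B0 = 0] by continuity. *)
pose H i := pgrad (A i) (B i) - pgrad A0 (B i).
have H0 : H @ \oo --> (0 : 'M[R]_(m, r)).
  rewrite -(subrr (0 : 'M[R]_(m, r))) -[X in _ - X]A0B0.
  apply: (cvgB g0).
  exact: (cvg_pgrad (fun=> A0) B A0 B0 (cvg_cst A0) cB).
apply: (fdot0_cvg _ _ _ (fun i => lambda ^- 2 * fdot (H i) (H i))).
  move=> i; rewrite mulrC ler_pdivlMr ?exprn_gt0// mulrC /H pgradB.
  exact: ridge_op_coercive.
rewrite -(mulr0 (lambda ^- 2)); apply: cvgM; first exact: cvg_cst.
exact: cvg_fdot0.
Qed.

Lemma gradA_pgrad A B : gradA X Omega lambda A B = pgrad A B.
Proof.
apply/matrixP => i j; rewrite mxE.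
have [_ ->] := is_derive_FA X Omega lambda A B (delta_mx i j).
exact: fdot_delta.
Qed.

End PartialGradient.

(** * Transposing the data exchanges the roles of [A] and [B] *)

Section Transposition.
Context {R : realType} {m n r : nat}.
Context (X : 'M[R]_(m, n)) (Omega : {set 'I_m * 'I_n}) (lambda : R).
Implicit Types (A : 'M[R]_(m, r)) (B : 'M[R]_(n, r)).

Lemma F_tr A B : F X^T (trset Omega) lambda B A = F X Omega lambda A B.
Proof.
by rewrite /F -[in RHS]fnorm_tr trmx_POmega !raddfB/= trmx_mul trmxK addrAC.
Qed.

Lemma QA_tr Z A B : QA X^T (trset Omega) lambda Z B A = QB X Omega lambda Z A B.
Proof.
rewrite /QA /QB -[in RHS]fnorm_tr [in RHS]raddfD /= trmx_POmega trmx_POmega_perp.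
by rewrite !raddfB/= !trmx_mul !trmxK addrAC.
Qed.

Lemma gradB_pgrad A B : gradB X Omega lambda A B = pgrad X^T (trset Omega) lambda B A.
Proof.
rewrite -gradA_pgrad /gradA /gradB.
have -> : (fun B' => F X^T (trset Omega) lambda B' A) = F X Omega lambda A.
  by apply/funext => B'; exact: F_tr.
by [].
Qed.

End Transposition.

(** * Descent along the iterates and limits along subsequences *)

Section Iterates.
Context {R : realType} {m n r : nat}.
Context (X : 'M[R]_(m, n)) (Omega : {set 'I_m * 'I_n}) (lambda : R).
Hypothesis lambda_gt0 : 0 < lambda.
Context (A : nat -> 'M[R]_(m, r)) (B : nat -> 'M[R]_(n, r)).
Hypothesis AB_ALS : softImpute_ALS X Omega lambda A B.

Let stepA k : (1 <= k)%N ->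
  F X Omega lambda (A k.+1) (B k) + lambda / 2 * fnorm (A k - A k.+1) ^+ 2
    <= F X Omega lambda (A k) (B k) /\
  pgrad X Omega lambda (A k) (B k)
    = (A k - A k.+1) *m ((B k)^T *m B k + lambda%:M).
Proof. by move=> /AB_ALS[/(QA_step _ _ _ _ _ _ lambda_gt0)]. Qed.

Let stepB k : (1 <= k)%N ->
  F X Omega lambda (A k.+1) (B k.+1) + lambda / 2 * fnorm (B k - B k.+1) ^+ 2
    <= F X Omega lambda (A k.+1) (B k) /\
  pgrad X^T (trset Omega) lambda (B k) (A k.+1)
    = (B k - B k.+1) *m ((A k.+1)^T *m A k.+1 + lambda%:M).
Proof.
move=> /AB_ALS[_ minB]; rewrite -2!(F_tr X Omega).
apply: QA_step => // Z; rewrite !QA_tr; exact: minB.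
Qed.

(** Sum of the two half-step decreases, shifted by one because the recursion holds from index 1
    on. *)
Let decrease k :
  lambda / 2 * (fnorm (A k.+1 - A k.+2) ^+ 2 + fnorm (B k.+1 - B k.+2) ^+ 2)
  <= F X Omega lambda (A k.+1) (B k.+1) - F X Omega lambda (A k.+2) (B k.+2).
Proof. by have [] := stepA k.+1 isT; have [] := stepB k.+1 isT; lra. Qed.

(** The objective values are nonincreasing and bounded below by 0, so they converge and their
    successive differences vanish. *)
Let decrease_cvg0 :
  F X Omega lambda (A k.+1) (B k.+1) - F X Omega lambda (A k.+2) (B k.+2)
    @[k --> \oo] --> (0 : R).
Proof.
pose u k := F X Omega lambda (A k.+1) (B k.+1).
have /cvg_ex[l ul] : cvgn u.
  apply: nonincreasing_is_cvgn.
    apply/nonincreasing_seqP => k; rewrite -subr_ge0; apply: le_trans (decrease k).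
    by rewrite mulr_ge0 ?divr_ge0 ?addr_ge0 ?sqr_ge0// ltW.
  by exists 0 => _ [k _ <-]; exact: F_ge0 lambda_gt0.
rewrite -(subrr l); apply: cvgB => //.
by have := ul; rewrite -cvg_shiftS.
Qed.

Lemma successive_differences_cvg0 :
  A k - A k.+1 @[k --> \oo] --> (0 : 'M[R]_(m, r)) /\
  B k - B k.+1 @[k --> \oo] --> (0 : 'M[R]_(n, r)).
Proof.
have l2 : 0 < lambda / 2 by rewrite divr_gt0.
pose u k := (lambda / 2)^-1
  * (F X Omega lambda (A k.+1) (B k.+1) - F X Omega lambda (A k.+2) (B k.+2)).
have u0 : u @ \oo --> (0 : R).
  by rewrite -(mulr0 (lambda / 2)^-1); apply: cvgM decrease_cvg0; exact: cvg_cst.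
have uE k : fnorm (A k.+1 - A k.+2) ^+ 2 + fnorm (B k.+1 - B k.+2) ^+ 2 <= u k.
  by rewrite /u mulrC ler_pdivlMr// mulrC; exact: decrease.
split.
  have dA : A k.+1 - A k.+2 @[k --> \oo] --> (0 : 'M[R]_(m, r)).
    apply: fdot0_cvg u0 => k; apply: le_trans (uE k).
    by rewrite -fnorm_sqr lerDl sqr_ge0.
  by move: dA; rewrite (cvg_shiftS (fun k => A k - A k.+1)).
have dB : B k.+1 - B k.+2 @[k --> \oo] --> (0 : 'M[R]_(n, r)).
  apply: fdot0_cvg u0 => k; apply: le_trans (uE k).
  by rewrite -fnorm_sqr lerDr sqr_ge0.
by move: dB; rewrite (cvg_shiftS (fun k => B k - B k.+1)).
Qed.

Section Subsequence.
Context (nu : nat -> nat).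
Hypothesis nu_subseq : subsequence_of_pos nu.

(** Needed because the half-step in [B] starts from the already updated [A (nu i).+1]. *)
Lemma subseq_succ_cvgA A0 : A (nu i) @[i --> \oo] --> (A0 : 'M[R]_(m, r)) ->
  A (nu i).+1 @[i --> \oo] --> A0.
Proof.
move=> cA; have [dA _] := successive_differences_cvg0.
rewrite (_ : (fun i => A (nu i).+1) = fun i => A (nu i) - (A (nu i) - A (nu i).+1)).
  rewrite -(subr0 A0); apply: (cvgB cA).
  exact: (increasing_cvg_oo (fun k => A k - A k.+1) _ _ nu_subseq.2 dA).
by apply/funext => i; rewrite subKr.
Qed.

Lemma pgradA_cvg0 B0 : B (nu i) @[i --> \oo] --> (B0 : 'M[R]_(n, r)) ->
  pgrad X Omega lambda (A (nu i)) (B (nu i)) @[i --> \oo] --> (0 : 'M[R]_(m, r)).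
Proof.
move=> cB; have [dA _] := successive_differences_cvg0.
apply: (pgrad_cvg_zero _ _ _ _ _ _ _ cB
  (increasing_cvg_oo _ _ _ nu_subseq.2 dA)) => i.
by have [] := stepA (nu i) (nu_subseq.1 i).
Qed.

Lemma pgradB_cvg0 A0 : A (nu i) @[i --> \oo] --> (A0 : 'M[R]_(m, r)) ->
  pgrad X^T (trset Omega) lambda (B (nu i)) (A (nu i).+1) @[i --> \oo]
    --> (0 : 'M[R]_(n, r)).
Proof.
move=> /subseq_succ_cvgA cA; have [_ dB] := successive_differences_cvg0.
apply: (pgrad_cvg_zero _ _ _ _ _ _ _ cA
  (increasing_cvg_oo _ _ _ nu_subseq.2 dB)) => i.
by have [] := stepB (nu i) (nu_subseq.1 i).
Qed.

End Subsequence.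

End Iterates.

Theorem theorem5 (R : realType) (m n r : nat) (hr : (r <= minn m n)%N)
    (X : 'M[R]_(m, n)) (Omega : {set 'I_m * 'I_n})
    (lambda : R) (hlambda : 0 < lambda)
    (A : nat -> 'M[R]_(m, r)) (B : nat -> 'M[R]_(n, r))
    (hAB : softImpute_ALS X Omega lambda A B) :
  (forall (Astar : 'M[R]_(m, r)) (Bstar : 'M[R]_(n, r)),
     seq_limit_point (fun k => (A k, B k)) (Astar, Bstar) ->
     stationary X Omega lambda Astar Bstar) /\
  (forall (Bstar : 'M[R]_(n, r)) (nu : nat -> nat),
     subsequence_of_pos nu ->
     (fun i => B (nu i)) @ \oo --> Bstar ->
     cvg ((fun i => A (nu i)) @ \oo)) /\
  (forall (Astar : 'M[R]_(m, r)) (mu : nat -> nat),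
     subsequence_of_pos mu ->
     (fun i => A (mu i)) @ \oo --> Astar ->
     cvg ((fun i => B (mu i)) @ \oo)).
Proof.
split; [|split].
- move=> Astar Bstar [nu [nu_subseq cAB]].
  have cA : A (nu i) @[i --> \oo] --> Astar.
    exact: (cvg_comp _ fst cAB cvg_fst).
  have cB : B (nu i) @[i --> \oo] --> Bstar.
    exact: (cvg_comp _ snd cAB cvg_snd).
  have cA1 := subseq_succ_cvgA _ _ _ hlambda _ _ hAB _ nu_subseq _ cA.
  (* Each gradient has two limits along the subsequence, its value at the limit point and 0, which
     must coincide. The gradient in [B] is followed at [(A (nu i).+1, B (nu i))], hence [cA1]. *)
  rewrite /stationary gradA_pgrad gradB_pgrad; split.
  + exact: cvg_unique (cvg_pgrad _ _ _ _ _ _ _ cA cB)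
      (pgradA_cvg0 _ _ _ hlambda _ _ hAB _ nu_subseq _ cB).
  + exact: cvg_unique (cvg_pgrad _ _ _ _ _ _ _ cB cA1)
      (pgradB_cvg0 _ _ _ hlambda _ _ hAB _ nu_subseq _ cA).
- move=> Bstar nu nu_subseq cB; apply: (cvg_of_pgrad _ _ _ _ _ _ hlambda cB).
  exact: (pgradA_cvg0 _ _ _ hlambda _ _ hAB _ nu_subseq _ cB).
- move=> Astar mu mu_subseq cA.
  (* In the transposed problem the convergent factor is [A (mu i).+1], which has the same limit as
     [A (mu i)]. *)
  apply: (cvg_of_pgrad _ _ _ _ _ _ hlambda
    (subseq_succ_cvgA _ _ _ hlambda _ _ hAB _ mu_subseq _ cA)).
  exact: (pgradB_cvg0 _ _ _ hlambda _ _ hAB _ mu_subseq _ cA).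
Qed.
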